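(* Let $q$ be a power of an odd prime. Let $a_1\in\mathbb{F}_{q^4}^*$ be such that $a_1^{q^2+1}$ is a square of an element of $\mathbb{F}_q^*$, and let $\tilde a_0\in\mathbb{F}_{q^4}$ satisfy $\mathrm{Tr}_{q^4/q}(\tilde a_0)=-1$. Define $x*y=xy+\mathrm{Tr}_{q^4/q}(a_1xy^{q^2}+\tilde a_0xy)$ on $\mathbb{F}_{q^4}$. Then $(\mathbb{F}_{q^4},+,* )$ is a presemifield, and it is isotopic to a commutative semifield.
   Context: $\mathrm{Tr}_{q^4/q}$ is the trace from $\mathbb{F}_{q^4}$ to $\mathbb{F}_q$. A presemifield is a finite set with operations $+,*$ such that $(\mathbb{S},+)$ is a group, both distributive laws hold, and $x*y=0$ implies $x=0$ or $y=0$; a semifield is a presemifield with a two-sided multiplicative identity. Presemifields $(\mathbb{F}_{q^4},+,* )$ and $(\mathbb{F}_{q^4},+,\star)$ are isotopic if there are additive bijections $L,M,N$ of $\mathbb{F}_{q^4}$ with $M(x)\star N(y)=L(x*y)$ for all $x,y$. *)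

(* Defs.v *)
From HB Require Import structures.
From mathcomp Require Export all_boot all_order all_algebra all_fingroup all_field.

Set Implicit Arguments.
Unset Strict Implicit.
Unset Printing Implicit Defensive.

Import GRing.Theory.
Local Open Scope ring_scope.

(* (S, +) being a finite group is part of the structure [finZmodType]. *)
Record presemifield (S : finZmodType) (mul : S -> S -> S) : Prop :=
  Presemifield {
    presemifield_mulDl : forall x y z : S, mul (x + y) z = mul x z + mul y z;
    presemifield_mulDr : forall x y z : S, mul x (y + z) = mul x y + mul x z;
    presemifield_integral : forall x y : S, mul x y = 0 -> x = 0 \/ y = 0
  }.

Definition semifield (S : finZmodType) (mul : S -> S -> S) : Prop :=
  presemifield mul /\
  exists e : S, forall x : S, mul e x = x /\ mul x e = x.

Definition commutative_semifield (S : finZmodType) (mul : S -> S -> S) : Prop :=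
  semifield mul /\ forall x y : S, mul x y = mul y x.

Definition additive_bijection (S : finZmodType) (f : S -> S) : Prop :=
  (forall x y : S, f (x + y) = f x + f y) /\ bijective f.

Definition isotopic (S : finZmodType) (mul star : S -> S -> S) : Prop :=
  exists L M N : S -> S,
    [/\ additive_bijection L, additive_bijection M, additive_bijection N &
        forall x y : S, star (M x) (N y) = L (mul x y)].

(* [finvect_type E] is E itself, with its finite field and splitting field
   structures. The trace is valued in E, as the element of the image 1%VS of
   Fq. *)
Definition Tr (Fq : finFieldType) (E : fieldExtType Fq)
    (x : finvect_type E) : finvect_type E :=
  galTrace 1%VS {: finvect_type E}%VS x.

Definition mul_a1_a0 (Fq : finFieldType) (E : fieldExtType Fq)
    (a1 a0 x y : finvect_type E) : finvect_type E :=
  x * y + Tr (a1 * x * y ^+ (#|Fq| ^ 2) + a0 * x * y).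

(* Main.v *)
Require Import Defs.
From mathcomp Require Import cyclic ring.
Import GRing.Theory.
Local Open Scope ring_scope.

Set Implicit Arguments.
Unset Strict Implicit.
Unset Printing Implicit Defensive.

(** Write [s] for the [q]-Frobenius.  If [x * y = 0] with [x, y] nonzero, then
    [x y] lies in [Fq], so [Tr a0 = -1] reduces the equation to [Tr u = 0] for
    [u = a1 y^(q^2 - 1)], an element with [u u^(q^2) = b^2] and [b] in [Fq].
    The square of [d = u - u^(q^2)] is [(u + u^(q^2))^2 - 4 b^2], which is fixed
    by [s] because [s] negates [u + u^(q^2)]; thus [d^(q^2) = d], whereas
    [d^(q^2) = -d].  Hence [u] is in [F_(q^2)], so [u = b] or [u = -b], and its
    trace [4 u] is not zero.

    For commutativity, [x * (a1 y)] is symmetric in [x] and [y], because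
    [a1^(q^2 + 1)] is fixed by the Frobenius; Kaplansky's trick then turns a
    commutative presemifield into a commutative semifield. *)

Lemma additive_bijection_of_ker0 (S : finZmodType) (f : S -> S) :
  (forall x y, f (x + y) = f x + f y) -> (forall x, f x = 0 -> x = 0) ->
  additive_bijection f.
Proof.
move=> fD f0; split=> //; apply: injF_bij => x y fxy.
have fy0 : f 0 = 0 by apply: (addrI (f 0)); rewrite -fD !addr0.
apply/eqP; rewrite -subr_eq0; apply/eqP/f0; apply: (addIr (f y)).
by rewrite -fD subrK add0r.
Qed.

(** Kaplansky's trick: with the commutative product [x o y = mul x (N y)] and the bijection
    [R x = x o e], put [star x y = R^-1 x o R^-1 y]. Its identity is [R e], because
    [e o R^-1 x = R^-1 x o e = x]. *)
Lemma isotopic_commutative_semifield (S : finZmodType) (mul : S -> S -> S)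
    (N : S -> S) (e : S) :
  presemifield mul -> additive_bijection N -> e != 0 ->
  (forall x y, mul x (N y) = mul y (N x)) ->
  exists star : S -> S -> S, commutative_semifield star /\ isotopic mul star.
Proof.
case=> mulDl mulDr mul_eq0 [ND [Ninv NK NinvK]] e0 mulC.
have N_eq0 x : N x = 0 -> x = 0.
  have N0 : N 0 = 0 by apply: (addrI (N 0)); rewrite -ND !addr0.
  by rewrite -[in N x = 0]N0 => /(can_inj NK).
have NinvD x y : Ninv (x + y) = Ninv x + Ninv y.
  by apply: (can_inj NK); rewrite ND !NinvK.
pose R x := mul x (N e).
have Radd x y : R (x + y) = R x + R y by rewrite /R mulDl.
have Rab : additive_bijection R.
  apply: additive_bijection_of_ker0 => // x /mul_eq0[] // /N_eq0 e_eq0.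
  by rewrite e_eq0 eqxx in e0.
have [_ [g gK Kg]] := Rab.
have gD x y : g (x + y) = g x + g y.
  by apply: (can_inj gK); rewrite Radd !Kg.
have g_eq0 x : g x = 0 -> x = 0.
  move=> gx; rewrite -(Kg x) gx; apply: (addrI (R 0)).
  by rewrite -Radd !addr0.
have starC x y : mul (g x) (N (g y)) = mul (g y) (N (g x)) by apply: mulC.
exists (fun x y => mul (g x) (N (g y))); split.
  split=> //; split.
    split=> [x y z|x y z|x y]; rewrite ?gD ?ND ?mulDl ?mulDr //.
    by case/mul_eq0=> [/g_eq0|/N_eq0/g_eq0]; [left | right].
  by exists (R e) => x; split; first rewrite mulC; rewrite gK [LHS]Kg.
(* [Ninv] undoes the twist by [N] inside [star], so that [L] can be the identity. *)
exists id, R, (fun y => R (Ninv y)); split=> //.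
- by split=> //; exists id.
- split=> [x y|]; first by rewrite NinvD Radd.
  by exists (fun y => N (g y)) => x; rewrite ?gK ?NinvK ?NK ?Kg.
- by move=> x y; rewrite !gK NinvK.
Qed.

Lemma trace_neq0 (F : fieldType) (s : {rmorphism F -> F}) (u b : F) :
  (forall x, s (s (s (s x))) = x) -> 2%:R != 0 :> F -> b != 0 -> s b = b ->
  u * s (s u) = b ^+ 2 -> u + s u + s (s u) + s (s (s u)) != 0.
Proof.
move=> s4 nz2 nzb sb uu; apply/eqP => tr0.
have dbl0 (x : F) : x = - x -> x = 0.
  move=> xN; have /eqP : 2%:R * x = 0 by rewrite mulr_natl mulr2n {1}xN addNr.
  by rewrite mulf_eq0 (negbTE nz2) => /eqP.
set d := u - s (s u).
have sw : s (u + s (s u)) = - (u + s (s u)).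
  by apply/eqP; rewrite -addr_eq0 rmorphD /= -[X in _ == X]tr0; apply/eqP; ring.
have d2 : d ^+ 2 = (u + s (s u)) ^+ 2 - 4%:R * b ^+ 2.
  by rewrite -uu /d; ring.
have sd2 : s d ^+ 2 = d ^+ 2.
  rewrite -rmorphXn d2 rmorphB rmorphXn sw sqrrN.
  by rewrite rmorphM rmorph_nat rmorphXn /= sb.
have ssd : s (s d) = d.
  (* Here [s d] is [d] or [- d]; in both cases a second [s] returns [d]. *)
  by move/eqP: sd2; rewrite eqf_sqr => /orP[]/eqP e; rewrite !(e, rmorphN) ?opprK.
have d0 : d = 0.
  by apply: dbl0; rewrite -[LHS]ssd /d !rmorphB /= s4 opprB.
have ssu : s (s u) = u by apply/esym/eqP; rewrite -subr_eq0 -/d d0.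
have su : s u = u.
  by move/eqP: uu; rewrite ssu -expr2 eqf_sqr => /orP[]/eqP->;
    rewrite ?rmorphN /= sb.
have u0 : u = 0.
  (* For [u] fixed by [s], [sw] says that [u + u] is its own negative; [dbl0] is applied to [u + u],
     then to [u]. *)
  move: sw; rewrite ssu rmorphD /= su => /dbl0/eqP.
  by rewrite addr_eq0 => /eqP/dbl0.
by move/eqP: uu; rewrite u0 mul0r eq_sym expf_eq0 /= (negbTE nzb).
Qed.

Lemma big_cycle (R : Type) (idx : R) (op : Monoid.com_law idx)
    (gT : finGroupType) (a : gT) (F : gT -> R) :
  \big[op/idx]_(x in <[a]>%g) F x = \big[op/idx]_(i < #[a]%g) F (a ^+ i)%g.
Proof.
pose e (i : 'I_#[a]%g) := (a ^+ i)%g.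
have e_inj : injective e.
  by move=> i j /eqP; rewrite /e eq_expg_ord // => /eqP.
transitivity (\big[op/idx]_(x in e @: setT) F x); last first.
  rewrite big_imset /=; last exact: in2W.
  by apply: eq_bigl => i; rewrite inE.
apply: eq_bigl => x; apply/idP/imsetP => [/cyclePmin[i ltia ->]|[i _ ->]].
  by exists (Ordinal ltia).
exact: mem_cycle.
Qed.

(** The Galois group is cyclic, generated by the Frobenius, and its order is the degree 4. Keeping
    the Frobenius as a ring morphism [s] turns later computations with [q]-th powers into ring
    identities. *)
Lemma galTrace_frobenius4 (F : finFieldType) (L : splittingFieldType F) :
  \dim {: L} = 4%N ->
  exists s : {rmorphism L -> L},
    [/\ forall x, s x = x ^+ #|F|,
        forall x, s (s (s (s x))) = x,
        forall c : F, s c%:A = c%:A &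
        forall x, galTrace 1%VS {: L}%VS x = x + s x + s (s x) + s (s (s x))].
Proof.
move=> dimL; have sub1L : (1%AS <= {: L})%VS by apply: subvf.
have [a gen_a aE] := finField_galois_generator sub1L.
have galL : ('Gal({: L} / 1) = <[a]>)%g by apply/eqP.
have card_a : #[a]%g = 4%N.
  by rewrite orderE -galL -(galois_dim (finField_galois sub1L)) dimv1 divn1.
have aX i x : (a ^+ i.+1)%g x = a ((a ^+ i)%g x).
  by rewrite expgSr galM ?memvf.
exists a; split=> [x|x|c|x] /=.
- by rewrite aE ?memvf // dimv1 expn1.
- have := gal_id {: L}%AS x.
  by rewrite -{1}(expg_order a) card_a !aX gal_id.
- apply: (fixed_gal sub1L); last exact: rpredZ (mem1v _).
  by rewrite galL cycle_id.
- rewrite /galTrace galL big_cycle card_a !big_ord_recr big_ord0 /=.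
  by rewrite !aX gal_id add0r.
Qed.

Lemma trace_mul_commutative_isotope (F : finFieldType)
    (s : {rmorphism F -> F}) (T : F -> F) (mul : F -> F -> F) (a1 a0 b : F) :
  2%:R != 0 :> F -> (forall x, s (s (s (s x))) = x) ->
  (forall x, T x = x + s x + s (s x) + s (s (s x))) ->
  (forall x y, mul x y = x * y + T (a1 * x * s (s y) + a0 * x * y)) ->
  b != 0 -> s b = b -> a1 * s (s a1) = b ^+ 2 -> T a0 = -1 ->
  presemifield mul /\
  exists star : F -> F -> F, commutative_semifield star /\ isotopic mul star.
Proof.
move=> nz2 s4 TE mulE nzb sb a1N Ta0.
have nza1 : a1 != 0.
  by apply: contra_eq_neq a1N => ->; rewrite mul0r eq_sym expf_neq0.
have TD x y : T (x + y) = T x + T y by rewrite !TE !rmorphD /=; ring.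
have sT x : s (T x) = T x by rewrite !TE !rmorphD /= s4; ring.
have TZ c x : s c = c -> T (c * x) = c * T x.
  by move=> sc; rewrite !TE !(rmorphM, sc) /=; ring.
have Tss x : T (s (s x)) = T x by rewrite !TE !s4; ring.
have psf : presemifield mul.
  split=> [x y z|x y z|x y].
  - by rewrite !mulE !(mulrDr, mulrDl, TD); ring.
  - by rewrite !mulE !rmorphD /= !(mulrDr, mulrDl, TD); ring.
  rewrite mulE => xy0; have [->|nzx] := eqVneq x 0; first by left.
  have [->|nzy] := eqVneq y 0; first by right.
  (* By [xy0], [x * y] is the negative of a trace. *)
  have sxy : s (x * y) = x * y.
    by move/eqP: xy0; rewrite addr_eq0 => /eqP->; rewrite rmorphN /= sT.
  pose u := a1 * s (s y) / y.
  have nzTu : T u != 0.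
    rewrite TE; apply: (trace_neq0 s4 nz2 nzb sb).
    have nzssy : s (s y) != 0 by rewrite !fmorph_eq0.
    (* In [u * s (s u)] the factors [y] and [s (s y)] cancel, leaving [a1 * s (s a1)]. *)
    by rewrite -a1N /u !(rmorphM, fmorphV) /= s4; field; rewrite nzy nzssy.
  suff xyTu : x * y * T u = 0.
    by have := mulf_neq0 (mulf_neq0 nzx nzy) nzTu; rewrite xyTu eqxx.
  (* Since [x * y] leaves the trace, the [a0] term equals [- (x * y)] and cancels the leading
     product. *)
  rewrite -TZ // -xy0 TD.
  have -> : a0 * x * y = x * y * a0 by ring.
  have -> : a1 * x * s (s y) = x * y * u by rewrite /u; field.
  by rewrite [T (x * y * a0)]TZ // Ta0; ring.
split=> //; apply: (isotopic_commutative_semifield (N := *%R a1) (e := 1)) => //.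
- split; first exact: mulrDr.
  by exists ( *%R a1^-1) => x; [apply: mulKf | apply: mulVKf].
- exact: oner_neq0.
have T_a1 x y : T (a1 * x * s (s (a1 * y))) = b ^+ 2 * T (x * s (s y)).
  rewrite -TZ ?rmorphXn /= ?sb // -a1N; congr (T _).
  by rewrite !rmorphM /=; ring.
(* Applying [s] twice inside the trace turns [y * s (s x)] into [x * s (s y)]; the other terms are
   symmetric as they stand. *)
move=> x y; rewrite !mulE !TD !T_a1 -[T (y * _)]Tss !rmorphM /= s4.
by congr (_ + (_ * T _ + T _)); ring.
Qed.

Theorem theorem3p5 (p k q : nat) (p_prime : prime p) (p_odd : odd p)
    (k_gt0 : (0 < k)%N) (def_q : q = (p ^ k)%N)
    (Fq : finFieldType) (card_Fq : #|Fq| = q)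
    (Fq4 : fieldExtType Fq) (dim_Fq4 : \dim {: Fq4} = 4%N)
    (a1 a0 : finvect_type Fq4)
    (a1_neq0 : a1 != 0)
    (a1_norm : exists2 b : Fq, b != 0 & a1 ^+ (q ^ 2 + 1) = (b ^+ 2)%:A)
    (Tr_a0 : Tr a0 = -1) :
  presemifield (mul_a1_a0 a1 a0) /\
  exists star : finvect_type Fq4 -> finvect_type Fq4 -> finvect_type Fq4,
    commutative_semifield star /\ isotopic (mul_a1_a0 a1 a0) star.
Proof.
have [s [sE s4 sFq TrE]] := @galTrace_frobenius4 Fq (finvect_type Fq4) dim_Fq4.
case: a1_norm => b nzb a1b.
apply: (@trace_mul_commutative_isotope (finvect_type Fq4) s (@Tr Fq Fq4)
  (mul_a1_a0 a1 a0) a1 a0 b%:A _ s4 TrE _ _ _ _ Tr_a0).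
(* The extension has characteristic [p], so [2 = 0] would force [p = 2], which is not odd. *)
- have charFq := card_finPcharP (etrans card_Fq def_q) p_prime.
  rewrite -(pchar_lalg (finvect_type Fq4)) in charFq.
  rewrite -(dvdn_pcharf charFq) dvdn_prime2 //.
  by apply: contraTneq p_odd => ->.
- by move=> x y; rewrite /mul_a1_a0 !sE -exprM.
- by rewrite scaler_eq0 oner_eq0 orbF.
- exact: sFq.
- by rewrite !sE -exprM -exprS -addn1 card_Fq a1b -!in_algE rmorphXn.
Qed.
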